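(* Let $a<b$, $x_a,x_b>0$, and let $\gamma$ be a kinetically admissible path on $[a,b]$ with $\gamma(a)=x_a$ and $\gamma(b)=x_b$. Let $$\gamma_*(t)=\exp\!\left(\log x_a+\frac{t-a}{b-a}(\log x_b-\log x_a)\right),\qquad \dot\xi_*:=\frac{\log x_b-\log x_a}{b-a}.$$ Writing $\xi:=\log\gamma$, $$\mathcal{A}[\gamma]=\mathcal{A}[\gamma_*]+\int_a^b D_K\bigl(\dot\xi(t)\,\|\,\dot\xi_*\bigr)\,dt.$$ In particular, $$\mathcal{A}[\gamma]-\mathcal{A}[\gamma_*]\;\ge\;\tfrac12\int_a^b\bigl(\dot\xi(t)-\dot\xi_*\bigr)^2\,dt=\tfrac12\|\dot\xi-\dot\xi_*\|_{L^2([a,b])}^2,$$ with equality if and only if $\gamma\equiv\gamma_*$ on $[a,b]$.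
   Context: For $a<b$, an admissible path on $[a,b]$ is an absolutely continuous function $\gamma:[a,b]\to(0,\infty)$ (strictly positive at every point) with $\dot\gamma\in L^2([a,b])$. Its log-coordinate is $\xi:=\log\gamma$, which is absolutely continuous with $\dot\xi=\dot\gamma/\gamma\in L^2([a,b])$. Put $K(v):=\cosh(v)-1$. An admissible path $\gamma$ is kinetically admissible if $\int_a^b K(\dot\xi(t))\,dt<\infty$. For a kinetically admissible path the kinetic action is $\mathcal{A}[\gamma]:=\int_a^b K(\dot\xi(t))\,dt$. The cosh Bregman divergence is $D_K(v\,\|\,w):=K(v)-K(w)-K'(w)(v-w)=\cosh v-\cosh w-\sinh(w)(v-w)$ for $v,w\in\mathbb{R}$. *)

(* Defs.v *)
From HB Require Import structures.
From mathcomp Require Import all_boot all_order all_algebra.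
From mathcomp Require Import all_classical all_reals all_analysis.

Set Implicit Arguments.
Unset Strict Implicit.
Unset Printing Implicit Defensive.
Import Order.TTheory GRing.Theory Num.Theory.
Import numFieldNormedType.Exports.

Local Open Scope classical_set_scope.
Local Open Scope ring_scope.

(* A function on [a, b] is represented by a total function R -> R of which only
   the values on [a, b] are constrained. The dot derivative is the library's
   total derive1 f, an ordinary limit of difference quotients with value 0 where
   that limit does not exist. The values of f outside [a, b] can affect derive1 f
   on [a, b] only at the two endpoints, and for f absolutely continuous on
   [a, b] the default value is used only on a null set, so derive1 f represents
   the a.e. derivative of f on [a, b]. *)

Section Paths.
Context {R : realType}.
Implicit Types (a b : R) (f gamma : R -> R).

Definition abs_continuous a b f : Prop :=
  forall e : R, 0 < e -> exists2 d : R, 0 < d &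
    forall (n : nat) (x y : 'I_n -> R),
      (forall i, [/\ a <= x i, x i < y i & y i <= b]) ->
      trivIset [set: 'I_n] (fun i => `]x i, y i[%classic) ->
      \sum_(i < n) (y i - x i) < d ->
      \sum_(i < n) `|f (y i) - f (x i)| < e.

(* L^2([a, b]) for Lebesgue measure, through extension by 0 outside [a, b]. *)
Definition in_L2 a b f : Prop :=
  f \_ `[a, b] \in Lfun (@lebesgue_measure R) 2%:E.

Definition L2_norm a b f : \bar R :=
  'N[@lebesgue_measure R]_2%:E [EFin \o (f \_ `[a, b])].

Definition admissible a b gamma : Prop :=
  [/\ forall t, t \in `[a, b] -> 0 < gamma t,
      abs_continuous a b gamma
    & in_L2 a b (derive1 gamma)].

Definition log_coord gamma : R -> R := fun t => ln (gamma t).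

Definition cosh (v : R) : R := (expR v + expR (- v)) / 2.
Definition sinh (v : R) : R := (expR v - expR (- v)) / 2.

Definition K (v : R) : R := cosh v - 1.

(* The integrand is nonnegative, so this is a well-defined element of
   [0, +oo]. *)
Definition kinetic_action a b gamma : \bar R :=
  (\int[lebesgue_measure]_(t in `[a, b]) (K (derive1 (log_coord gamma) t))%:E)%E.

Definition kinetically_admissible a b gamma : Prop :=
  admissible a b gamma /\ (kinetic_action a b gamma < +oo)%E.

Definition cosh_bregman (v w : R) : R := K v - K w - derive1 K w * (v - w).

Lemma K_derive1 (w : R) : derive1 K w = sinh w.
Proof.
rewrite derive1E.
have H : is_derive w 1 (fun v : R => expR (- v)) (- expR (- w)).
  by apply: is_derive_eq; rewrite mulrN1.
have -> : K = (fun v : R => 2^-1 *: (expR v + expR (- v)) - 1).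
  by apply/funext => v; rewrite /K /cosh mulrC.
have D : is_derive w 1 (fun v : R => 2^-1 *: (expR v + expR (- v)) - 1)
    (2^-1 *: (expR w + - expR (- w)) - 0).
  by apply: is_deriveB.
by rewrite derive_val subr0 /sinh mulrC.
Qed.

Lemma cosh_bregmanE (v w : R) :
  cosh_bregman v w = cosh v - cosh w - sinh w * (v - w).
Proof.
by rewrite /cosh_bregman K_derive1 /K opprB addrA subrK.
Qed.

Definition log_slope a b (xa xb : R) : R := (ln xb - ln xa) / (b - a).

Definition log_linear_path a b (xa xb : R) : R -> R :=
  fun t => expR (ln xa + (t - a) / (b - a) * (ln xb - ln xa)).

End Paths.

(* Main.v *)
(* Only the log-coordinate matters: by the definition of the Bregman divergence,
   K(v) = K(w) + sinh(w) (v - w) + D_K(v || w), and the linear term integrates to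
   0 over [a, b] for v = xi' and w = xi_*' because xi is absolutely continuous
   with the same end values as xi_*. The bound D_K(v || w) >= (v - w)^2 / 2,
   strict for v <> w, holds because sinh - id is strictly increasing; in the
   equality case xi' = xi_*' almost everywhere, and integrating gives xi = xi_*.

   The fundamental theorem of calculus for an absolutely continuous f is obtained
   by writing f as a difference of two nondecreasing absolutely continuous
   functions V and V - f, with V the total variation of f. The Lebesgue-Stieltjes
   measure of such a function vanishes on Lebesgue-null sets, so it has a
   Radon-Nikodym density g; Lebesgue differentiation gives f' = g almost
   everywhere. *)
Require Import Defs.
From HB Require Import structures.
From mathcomp Require Import all_boot all_order all_algebra.
From mathcomp Require Import all_classical all_reals all_analysis.
From mathcomp Require Import finmap ring lra measurable_realfun.
Import Order.TTheory GRing.Theory Num.Theory.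
Import numFieldNormedType.Exports.
Local Open Scope classical_set_scope.
Local Open Scope ring_scope.

(** * Absolute continuity and total variation *)

(** Degenerate intervals add 0 to both sums, so they are dropped and the others renumbered by
    ordinals. Arbitrary finite index types make room for the cells of several partitions, indexed by
    dependent pairs. *)
Lemma abs_continuous_finType (R : realType) (a b : R) (f : R -> R) :
  abs_continuous a b f -> forall e : R, 0 < e -> exists2 d : R, 0 < d &
  forall (I : finType) (x y : I -> R),
    (forall i, [/\ a <= x i, x i <= y i & y i <= b]) ->
    trivIset [set: I] (fun i => `]x i, y i[%classic) ->
    \sum_i (y i - x i) < d -> \sum_i `|f (y i) - f (x i)| < e.
Proof.
move=> acf e /acf[d d0 H]; exists d => // I x y xy tI sd.
pose A : pred I := fun i => x i < y i.
have zeroA i : ~~ A i -> x i = y i.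
  move=> Ai; case: (xy i) => _ le_xy _; apply/eqP.
  by rewrite eq_le le_xy /= leNgt.
have restr (F : I -> R) : (forall i, ~~ A i -> F i = 0) ->
    \sum_i F i = \sum_(k < #|A|) F (enum_val k).
  move=> F0; rewrite (bigID A) /= [X in _ + X]big1 ?addr0//.
  exact: (big_enum_val F).
rewrite restr => [|i /zeroA ->]; last by rewrite subrr normr0.
apply: (H _ (x \o enum_val) (y \o enum_val)) => /=.
- move=> k; case: (xy (enum_val k)) => ? _ ?; split => //.
  exact: (enum_valP k).
- by move=> i j _ _ /= ij; exact/enum_val_inj/(tI _ _ Logic.I Logic.I).
- by rewrite -(restr (fun i => y i - x i))// => i /zeroA ->; rewrite subrr.
Qed.

(** Cutting disjoint intervals into cells keeps disjointness and total length, so the same [d] works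
    for variations along partitions. *)
Lemma abs_continuous_variation (R : realType) (a b : R) (f : R -> R) :
  abs_continuous a b f -> forall e : R, 0 < e -> exists2 d : R, 0 < d &
  forall (I : finType) (x y : I -> R) (s : I -> seq R),
    (forall i, [/\ a <= x i, itv_partition (x i) (y i) (s i) & y i <= b]) ->
    trivIset [set: I] (fun i => `]x i, y i[%classic) ->
    \sum_i (y i - x i) < d ->
    \sum_i variation (x i) (y i) f (s i) < e.
Proof.
move=> acf e /(abs_continuous_finType _ _ _ _ acf)[d d0 H].
exists d => // I x y s xy tI sd.
(* The cells of all the partitions [s i] form one finite disjoint family. *)
pose N i k := nth (y i) (x i :: s i) k.
have NS i k l : (k <= l)%N -> (l <= size (s i))%N -> N i k <= N i l.
  move=> kl ls; have [_ [ps _] _] := xy i.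
  have st : sorted <%O (x i :: s i) by [].
  by rewrite /N (lt_sorted_leq_nth _ st)// inE /= ltnS// (leq_trans kl).
have N0 i : N i 0 = x i by [].
have NN i : N i (size (s i)) = y i.
  by have [_ ps _] := xy i; exact: itv_partition_nth_size.
pose J := {i : I & 'I_(size (s i))}.
pose X (p : J) := N (tag p) (tagged p).
pose Y (p : J) := N (tag p) (tagged p).+1.
rewrite (_ : \sum_i _ = \sum_(p : J) `|f (Y p) - f (X p)|); last first.
  under eq_bigr do rewrite /variation big_mkord.
  by rewrite sig_big_dep.
apply: H.
- move=> [i k]; rewrite /X /Y/=; have [ax _ yb] := xy i; split.
  + by rewrite (le_trans ax)// -N0 NS// ltnW.
  + exact: NS.
  + by rewrite (le_trans _ yb)// -NN NS.
- move=> [i k] [j l] _ _ [z []]; rewrite /X /Y /= !in_itv /= => /andP[z1 z2] /andP[z3 z4].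
  (* Open cells with a common point lie in enclosing intervals that meet, so they belong to the same
     partition, where distinct cells are separated by a node. *)
  have /= ij : i = j.
    apply: tI => //; exists z; split; rewrite /= in_itv /=.
      rewrite -N0 -NN (le_lt_trans _ z1) ?(lt_le_trans z2)// NS//.
      by rewrite ltnW.
    rewrite -N0 -NN (le_lt_trans _ z3) ?(lt_le_trans z4)// NS//.
    by rewrite ltnW.
  subst j; congr (Tagged _ _); apply/val_inj => /=.
  case: (ltngtP k l) => // kl.
  + by have := lt_trans z3 z2; rewrite ltNge NS// ltnW.
  + by have := lt_trans z1 z4; rewrite ltNge NS// ltnW.
- rewrite (_ : \sum_(p : J) _ = \sum_i (y i - x i))//.
  transitivity (\sum_i \sum_(k < size (s i)) (N i k.+1 - N i k)).
    by rewrite sig_big_dep.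
  apply: eq_bigr => i _.
  by rewrite -(big_mkord xpredT (fun k => N i k.+1 - N i k)) telescope_sumr// N0 NN.
Qed.

(** A subinterval shorter than the [d] obtained for e = 1 has variation below 1 along every
    partition; additivity of the total variation then adds up finitely many such pieces. *)
Lemma abs_continuous_bounded_variation (R : realType) (a b : R) (f : R -> R) :
  a <= b -> abs_continuous a b f -> bounded_variation a b f.
Proof.
move=> ab /abs_continuous_variation/(_ 1 ltr01)[d d0 H].
have short u v : a <= u -> u <= v -> v <= b -> v - u < d ->
    bounded_variation u v f.
  move=> au uv vb uvd; exists 1 => _ [s ps <-]; apply/ltW.
  have := H 'I_1 (fun=> u) (fun=> v) (fun=> s); rewrite !big_ord1; apply => //.
  by move=> i j _ _ _; rewrite (ord1 i) (ord1 j).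
(* [n] exceeds (b - a) / d, so [n.+1] equal steps from a to b each have length below d. *)
pose n := Num.bound ((b - a) / d); pose h := (b - a) / n.+1%:R.
have h0 : 0 <= h by rewrite divr_ge0// subr_ge0.
have hd : h < d.
  rewrite /h ltr_pdivrMr// mulrC -ltr_pdivrMr//.
  rewrite (lt_trans (archi_boundP _))//; first by rewrite divr_ge0 ?subr_ge0// ltW.
  by rewrite ltr_nat.
have kb k : (k <= n.+1)%N -> a + h *+ k <= b.
  move=> kn; rewrite -lerBrDl -mulr_natr /h mulrAC ler_pdivrMr//.
  by rewrite ler_wpM2l ?subr_ge0// ler_nat.
have ak k : a <= a + h *+ k by rewrite lerDl mulrn_wge0.
suff BVk k : (k <= n.+1)%N -> bounded_variation a (a + h *+ k) f.
  have := BVk n.+1 (leqnn _).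
  by rewrite -mulr_natr /h divfK ?pnatr_eq0// addrC subrK.
elim: k => [_|k IH kn]; first by rewrite mulr0n addr0; exact: bounded_variationxx.
apply/bounded_variationP => //.
have kk : a + h *+ k <= a + h *+ k.+1 by rewrite lerD2l mulrSr lerDl.
rewrite (total_variationD f (ak k) kk) fin_numD; apply/andP; split.
  by apply/bounded_variationP => //; apply: IH; exact: ltnW.
apply/bounded_variationP => //; apply: short => //; first exact: kb.
by rewrite opprD addrACA subrr add0r mulrSr addrAC subrr add0r.
Qed.

(** An increment of the total variation function is the total variation over that interval, a
    supremum approached by variations along partitions, which [abs_continuous_variation] controls
    jointly. *)
Lemma abs_continuous_total_variation (R : realType) (a b : R) (f : R -> R) :
  a <= b -> abs_continuous a b f ->
  abs_continuous a b (fun t => fine (total_variation a t f)).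
Proof.
move=> ab acf e e0; have e20 : 0 < e / 2 by rewrite divr_gt0.
have bvf := abs_continuous_bounded_variation _ _ _ _ ab acf.
have [d d0 H] := abs_continuous_variation _ _ _ _ acf _ e20.
exists d => // n x y xy tI sd.
have fin u v : a <= u -> u <= v -> v <= b ->
    total_variation u v f \is a fin_num.
  move=> au uv vb; apply/bounded_variationP => //.
  apply: (bounded_variationl uv vb).
  exact: (bounded_variationr au (le_trans uv vb) bvf).
(* The [n] approximation errors sum to at most e / 2; the divisor is [n.+1] since [n] may be 0. *)
pose eta : R := e / 2 / n.+1%:R.
have eta0 : 0 < eta by rewrite divr_gt0.
have /choice[s sP] : forall i, exists s, itv_partition (x i) (y i) s /\
    fine (total_variation (x i) (y i) f) < variation (x i) (y i) f s + eta.
  move=> i; have [axi /ltW xyi yib] := xy i.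
  have F := fin _ _ axi xyi yib.
  have [_ [_ [s ps <-] <-] lt_s] := ub_ereal_sup_adherent eta0 F.
  exists s; split=> //; rewrite -lte_fin fineK// EFinD -lteBlDr//.
have VE i : `|fine (total_variation a (y i) f) - fine (total_variation a (x i) f)|
    = fine (total_variation (x i) (y i) f).
  have [axi /ltW xyi yib] := xy i.
  have F1 := fin _ _ (lexx a) axi (le_trans xyi yib).
  have F2 := fin _ _ axi xyi yib.
  rewrite (total_variationD f axi xyi) fineD// addrC addKr ger0_norm//.
  by rewrite fine_ge0// total_variation_ge0.
under eq_bigr do rewrite VE.
apply: (@le_lt_trans _ _ (\sum_(i < n) (variation (x i) (y i) f (s i) + eta))).
  by apply: ler_sum => i _; apply/ltW/(sP i).2.
rewrite big_split/= sumr_const card_ord [ltRHS]splitr ltr_leD//.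
  apply: H => // i; have [? _ ?] := xy i; split=> //; exact: (sP i).1.
rewrite -[eta *+ n]mulr_natr /eta mulrAC ler_pdivrMr// ler_wpM2l ?(ltW e20)//.
by rewrite ler_nat.
Qed.

Lemma abs_continuousD (R : realType) (a b : R) (f g : R -> R) :
  abs_continuous a b f -> abs_continuous a b g ->
  abs_continuous a b (fun t => f t + g t).
Proof.
move=> acf acg e e0; have e20 : 0 < e / 2 by rewrite divr_gt0.
have [d1 d10 H1] := acf _ e20; have [d2 d20 H2] := acg _ e20.
exists (Order.min d1 d2); first by rewrite lt_min d10.
move=> n x y xy tI; rewrite lt_min => /andP[sd1 sd2].
rewrite [ltRHS]splitr.
apply: le_lt_trans (ltrD (H1 _ _ _ xy tI sd1) (H2 _ _ _ xy tI sd2)).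
rewrite -big_split/=; apply: ler_sum => i _.
by rewrite (le_trans _ (ler_normD _ _))// opprD addrACA.
Qed.

Lemma abs_continuous_lipschitz_comp (R : realType) (a b k : R) (h f : R -> R) :
  0 < k -> (forall s t, s \in `[a, b] -> t \in `[a, b] ->
    `|h (f s) - h (f t)| <= k * `|f s - f t|) ->
  abs_continuous a b f -> abs_continuous a b (h \o f).
Proof.
move=> k0 lip acf e e0; have [d d0 H] := acf _ (divr_gt0 e0 k0).
exists d => // n x y xy tI sd.
have := H _ _ _ xy tI sd; rewrite ltr_pdivlMr// mulr_suml.
apply: le_lt_trans; apply: ler_sum => i _; rewrite mulrC.
have [axi /ltW xyi yib] := xy i.
by apply: lip; rewrite in_itv/= ?yib ?axi ?(le_trans axi) ?(le_trans xyi).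
Qed.

Lemma abs_continuous_uniform (R : realType) (a b : R) (f : R -> R) :
  abs_continuous a b f -> forall e : R, 0 < e -> exists2 d : R, 0 < d &
  forall s t, s \in `[a, b] -> t \in `[a, b] -> `|s - t| < d ->
    `|f s - f t| < e.
Proof.
move=> acf e e0; have [d d0 H] := acf _ e0; exists d => // s t sab tab.
wlog st : s t sab tab / s < t.
  move=> W; have [st|ts|->] := ltgtP s t; first exact: W.
    by move=> std; rewrite distrC; apply: W => //; rewrite distrC.
  by rewrite !subrr !normr0.
move=> std; have := H 1%N (fun=> s) (fun=> t); rewrite !big_ord1 distrC; apply.
- by move=> _; rewrite st; split; rewrite ?(itvP sab) ?(itvP tab).
- by move=> i j _ _ _; rewrite (ord1 i) (ord1 j).
- by apply: le_lt_trans std; rewrite distrC ler_norm.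
Qed.

Lemma abs_continuous_within_continuous (R : realType) (a b : R) (f : R -> R) :
  abs_continuous a b f -> {within `[a, b], continuous f}.
Proof.
move=> acf; apply/subspace_continuousP => x xab; apply/cvgrPdist_lt => e e0.
have [d d0 H] := abs_continuous_uniform _ _ _ _ acf _ e0.
rewrite near_withinE; apply: filterS (nbhsx_ballx x d d0) => s xs sab.
exact: H.
Qed.

(** * Lebesgue-Stieltjes measures of absolutely continuous functions *)

Lemma lebesgue_stieltjes_measure_oc (R : realType) (F : cumulative R R) (x y : R) :
  x <= y -> lebesgue_stieltjes_measure F `]x, y]%classic = (F y - F x)%:E.
Proof.
move=> xy; rewrite /lebesgue_stieltjes_measure /measure_extension.
by rewrite measurable_mu_extE /= ?wlength_itv_bnd//; exact: is_ocitv.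
Qed.

(** Absolute continuity speaks of disjoint intervals, while covers may overlap. The union lies in
    the ring generated by the half-open intervals, whose members are finite disjoint unions of
    nonempty such intervals. *)
Lemma ocitv_bigcup_disjoint (R : realType) (A : nat -> set R) (n : nat) :
  (forall k, ocitv (A k)) ->
  exists (m : nat) (x y : 'I_m -> R), [/\ forall i, x i < y i,
    trivIset [set: 'I_m] (fun i => `]x i, y i]%classic) &
    \big[setU/set0]_(k < n) A k = \big[setU/set0]_(i < m) `]x i, y i]%classic].
Proof.
move=> oA.
have mA : measurable (\big[setU/set0]_(k < n) A k : set (SetRing.type (ocitv_type R))).
  by apply: bigsetU_measurable => k _; apply: SetRing.measurable_subring; exact: oA.
have [B [finB B0 tB mB ->]] := SetRing.ring_finite_set mA.
have /finite_fsetP[S BS] := finB.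
have /choice[xy xyP] : forall i : S, exists p : R * R,
    p.1 < p.2 /\ val i = `]p.1, p.2]%classic.
  move=> i; have Bi : B (val i) by rewrite BS /=; exact: valP.
  have /ocitvP[i0|[p p12 iE]] : ocitv (val i) by apply: mB; exact/mem_set.
    by have /set0P := B0 _ Bi; rewrite i0 eqxx.
  by exists p.
pose ev (i : 'I_#|{: S}|) : S := enum_val i.
exists #|{: S}|, (fun i => (xy (ev i)).1), (fun i => (xy (ev i)).2).
split.
- by move=> i; exact: (xyP _).1.
- move=> i j _ _; rewrite -!(xyP _).2 => ij; apply/enum_val_inj/val_inj.
  by apply: tB ij; rewrite BS /=; exact: valP.
- rewrite BS -bigcup_pred; apply/seteqP; split=> [z [X XS Xz]|z [i _ iz]].
    exists (enum_rank [` XS]%fset) => //.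
    have E : ev (enum_rank [` XS]%fset) = [` XS]%fset by exact: enum_rankK.
    suff : `](xy [` XS]%fset).1, (xy [` XS]%fset).2]%classic z by rewrite E.
    by rewrite -(xyP _).2.
  by exists (val (ev i)); [exact: valP | rewrite (xyP _).2].
Qed.

(** A null set has a countable cover by half-open intervals of total length below [d]. Each finite
    part of it, cut to ]a, b] and made disjoint, has Stieltjes measure at most e by absolute
    continuity; continuity from below passes to the whole cover. *)
Lemma lebesgue_stieltjes_measure_null (R : realType) (a b : R) (F : cumulative R R)
    (N : set (measurableTypeR R)) :
  a < b -> abs_continuous a b F -> measurable N ->
  lebesgue_measure N = 0%E ->
  lebesgue_stieltjes_measure F (N `&` `]a, b]%classic) = 0%E.
Proof.
move=> ab acF mN N0; set nu := lebesgue_stieltjes_measure F.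
apply/eqP; rewrite eq_le measure_ge0 andbT.
apply/lee_addgt0Pr => e e0; rewrite add0e.
have [d d0 H] := acF _ e0.
have : (lebesgue_measure N < d%:E)%E by rewrite N0 lte_fin.
move=> /ereal_inf_lt[_ [A [oA NA] <-] Ad].
have moc u v : measurable (`]u, v]%classic : set (measurableTypeR R)).
  by apply: sub_sigma_algebra; exact: is_ocitv.
pose C k := A k `&` `]a, b]%classic.
have oC k : ocitv (C k) by apply: ocitvI; [exact: oA | exact: is_ocitv].
have mC k : measurable (C k : set (measurableTypeR R)).
  by apply: sub_sigma_algebra; exact: oC.
pose U n := \big[setU/set0]_(k < n.+1) C k.
have mU n : measurable (U n : set (measurableTypeR R)).
  by apply: bigsetU_measurable.
have mUU : measurable (\bigcup_n U n : set (measurableTypeR R)).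
  exact: bigcup_measurable.
have lenu : (nu (N `&` `]a, b]%classic) <= nu (\bigcup_n U n))%E.
  apply: le_measure; [apply/mem_set|exact/mem_set|].
    exact: (measurableI (N : set (measurableTypeR R)) _ mN (moc a b)).
  rewrite bigcup_bigsetU_bigcup => z [/NA[k _ Az] zab].
  by exists k.
apply: (le_trans lenu).
have ndU : nondecreasing_seq U.
  by move=> m n mn; exact/subsetPset/subset_bigsetU.
have cvU := nondecreasing_cvg_mu (mu := nu) mU mUU ndU.
have limU : lim (nu (U n) @[n --> \oo]) = nu (\bigcup_n U n).
  exact: (cvg_lim _ cvU).
rewrite -limU; apply: lime_le; first by apply/cvg_ex; eexists; exact: cvU.
apply: nearW => n /=.
have lamU : (lebesgue_measure (U n) < d%:E)%E.
  apply: le_lt_trans Ad.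
  apply: (le_trans (Boole_inequality lebesgue_measure (fun k _ => mC k))).
  apply: le_trans (nneseries_lim_ge n.+1 _); last by move=> k _ _; exact: measure_ge0.
  rewrite big_mkord; apply: lee_sum => k _.
  rewrite -(measurable_mu_extE _ (oA k)).
  by apply: le_mu_ext; exact: subIsetl.
have [m [x [y [xy tI UE]]]] := ocitv_bigcup_disjoint _ C n.+1 oC.
have Uab : U n `<=` `]a, b]%classic.
  by rewrite /U -bigcup_mkord => z [k _ []].
have xyab i : `]x i, y i]%classic `<=` `]a, b]%classic.
  apply: subset_trans Uab; rewrite /U UE -bigcup_pred => z zi.
  by exists i.
have bds i : [/\ a <= x i, x i < y i & y i <= b].
  split=> //.
    rewrite leNgt; apply/negP => xa.
    (* Were x i < a, this point would belong to the piece without being greater than a. *)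
    have /xyab : `]x i, y i]%classic (Order.min a (y i)).
      by rewrite /= in_itv/= lt_min xa xy ge_min lexx orbT.
    by rewrite /= in_itv/= ltNge ge_min lexx.
  have /xyab : `]x i, y i]%classic (y i) by rewrite /= in_itv/= xy lexx.
  by rewrite /= in_itv/= => /andP[].
rewrite /U UE in lamU *.
have tI' : trivIset [set: 'I_m]
    (fun i => `]x i, y i]%classic : set (measurableTypeR R)) := tI.
rewrite (measure_bigsetU_ord _ xpredT (fun i => moc (x i) (y i)) tI') in lamU.
have -> : nu (\big[setU/set0]_(i < m) `]x i, y i]%classic) =
    (\sum_(i < m) (F (y i) - F (x i))%:E)%E.
  transitivity (\sum_(i < m) nu `]x i, y i]%classic)%E.
    exact: (measure_bigsetU_ord nu xpredT (fun i => moc (x i) (y i)) tI').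
  by apply: eq_bigr => i _; rewrite /nu lebesgue_stieltjes_measure_oc ?(ltW (xy i)).
rewrite sumEFin lee_fin ltW//.
apply: le_lt_trans (H _ x y bds _ _).
- by apply: ler_sum => i _; exact: ler_norm.
- move=> i j _ _ [z [zi zj]]; apply: tI => //; exists z.
  by split; apply: subset_itv_oo_oc.
- rewrite -lte_fin -sumEFin; apply: le_lt_trans lamU.
  apply: lee_sum => i _.
  by rewrite [leRHS](lebesgue_stieltjes_measure_oc _ _ _ _ (ltW (xy i))).
Qed.

Lemma abs_continuous_nondecreasing_density (R : realType) (a b : R) (F : R -> R) :
  a < b -> abs_continuous a b F -> {in `[a, b] &, nondecreasing F} ->
  exists2 g : R -> R, lebesgue_measure.-integrable [set: R] (EFin \o g) &
    forall x, x \in `[a, b] ->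
      (\int[lebesgue_measure]_(t in `]a, x]) (g t)%:E = (F x - F a)%:E)%E.
Proof.
move=> ab acF ndF.
(* A cumulative function must be defined on the whole line: [F] is extended by
   its end values. *)
pose c t : R := Order.max a (Order.min b t).
have cab t : c t \in `[a, b].
  by rewrite in_itv/= /c le_max lexx ge_max ge_min lexx (ltW ab).
have cE t : t \in `[a, b] -> c t = t.
  by rewrite in_itv/= /c => /andP[at_ tb]; rewrite (min_idPr tb) (max_idPr at_).
(* Clamping to [a, b] is 1-Lipschitz, so the extended function stays continuous, in particular
   right-continuous. *)
have c1 s t : `|c s - c t| <= `|s - t|.
  wlog st : s t / s <= t.
    move=> W; have [/W //|/ltW/W] := leP s t.
    by rewrite distrC [leRHS]distrC.
  have cst : c s <= c t.
    by rewrite /c ge_max !le_max lexx /= le_min !ge_min lexx st !orbT.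
  rewrite distrC ger0_norm ?subr_ge0// distrC ger0_norm ?subr_ge0//.
  rewrite /c /Order.max /Order.min.
  by do !case: ifP; lra.
pose G t := F (c t).
have ndG : {homo G : s t / s <= t}.
  move=> s t st; apply: ndF => //.
  by rewrite /c ge_max !le_max lexx /= le_min !ge_min lexx st !orbT.
have rcG : continuous G.
  move=> t; apply/cvgrPdist_lt => e e0.
  have [d d0 H] := abs_continuous_uniform _ _ _ _ acF _ e0.
  near=> s; apply: H => //; apply: le_lt_trans (c1 _ _) _.
  by near: s; exact: cvgr_dist_lt.
pose mG := isCumulative.Build R _ R G ndG (right_continuousW rcG).
pose Gc : cumulative R R := HB.pack G mG.
have acG : abs_continuous a b Gc.
  move=> e /acF[d d0 H]; exists d => // n x y xy tI sd.
  rewrite (eq_bigr (fun i => `|F (y i) - F (x i)|)); first exact: H.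
  move=> i _; have [ax /ltW xy' yb] := xy i.
  by rewrite /= /G !cE// in_itv/= ?ax ?yb ?(le_trans xy') ?(le_trans ax).
pose nu := lebesgue_stieltjes_measure Gc.
have mab : measurable (`]a, b]%classic : set (measurableTypeR R)).
  by apply: sub_sigma_algebra; exact: is_ocitv.
have nuab : (nu `]a, b]%classic < +oo)%E.
  by rewrite /nu lebesgue_stieltjes_measure_oc ?(ltW ab)// ltry.
(* Cut down to ]a, b], the measure is finite and vanishes on Lebesgue-null sets by the previous
   lemma. *)
pose nur := mfrestr mab nuab.
have dom : nur `<< @lebesgue_measure R.
  apply/null_content_dominatesP => N mN N0.
  exact: lebesgue_stieltjes_measure_null.
have [h [_ hfin inth nuE]] := radon_nikodym_sigma_finite dom.
exists (fine \o h).
  by apply: eq_integrable inth => // t _ /=; rewrite fineK.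
move=> x xab.
have mx : measurable (`]a, x]%classic : set (measurableTypeR R)).
  by apply: sub_sigma_algebra; exact: is_ocitv.
under eq_integral do rewrite /= fineK//.
have abx : `]a, x]%classic `&` `]a, b]%classic = `]a, x]%classic.
  apply/setIidPl => t /=; rewrite !in_itv/= => /andP[-> /le_trans]; apply.
  by rewrite (itvP xab).
have nux : nur `]a, x]%classic = (F x - F a)%:E.
  transitivity (nu (`]a, x]%classic `&` `]a, b]%classic)) => //.
  rewrite abx /nu lebesgue_stieltjes_measure_oc ?(itvP xab)//= /G !cE//.
  by rewrite in_itv/= lexx ltW.
by rewrite -nux; apply/esym; exact: (nuE _ mx).
Unshelve. all: by end_near. Qed.

(** * The fundamental theorem of calculus *)

(** The claim on the derivative is confined to ]a, b[ because [derive1] is a two-sided limit and [f]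
    is arbitrary outside [a, b]. *)
Lemma abs_continuous_derive1 (R : realType) (a b : R) (f : R -> R) :
  a < b -> abs_continuous a b f ->
  exists g : R -> R, [/\ lebesgue_measure.-integrable [set: R] (EFin \o g),
    forall x, x \in `[a, b] ->
      (\int[lebesgue_measure]_(t in `]a, x]) (g t)%:E = (f x - f a)%:E)%E &
    {ae lebesgue_measure, forall t : R, t \in `]a, b[ -> derive1 f t = g t}].
Proof.
move=> ab acf.
pose V t := fine (total_variation a t f).
have acV : abs_continuous a b V by apply: abs_continuous_total_variation; first exact: ltW.
have bvf := abs_continuous_bounded_variation _ _ _ _ (ltW ab) acf.
(* This bound makes both V and V - f nondecreasing. *)
have VD s t : s \in `[a, b] -> t \in `[a, b] -> s <= t -> `|f t - f s| <= V t - V s.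
  move=> sab tab st.
  have as_ : a <= s by rewrite (itvP sab).
  have tb : t <= b by rewrite (itvP tab).
  have F1 : total_variation a s f \is a fin_num.
    apply/bounded_variationP => //; apply: (bounded_variationl as_ _ bvf).
    exact: le_trans tb.
  have F2 : total_variation s t f \is a fin_num.
    apply/bounded_variationP => //; apply: (bounded_variationl st tb).
    exact: (bounded_variationr as_ (le_trans st tb) bvf).
  rewrite /V (total_variationD f as_ st) fineD// addrAC subrr add0r.
  by rewrite -lee_fin fineK// total_variation_ge.
have ndV : {in `[a, b] &, nondecreasing V}.
  by move=> s t sab tab st; rewrite -subr_ge0 (le_trans _ (VD _ _ sab tab st)).
have ndW : {in `[a, b] &, nondecreasing (fun t => V t + - f t)}.
  move=> s t sab tab st; have := VD _ _ sab tab st.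
  by have := ler_norm (f t - f s); lra.
have acN : abs_continuous a b (fun t => - f t).
  apply: (abs_continuous_lipschitz_comp _ _ _ 1 -%R) acf => // s t _ _.
  by rewrite mul1r -opprD normrN.
have [g1 ig1 E1] := abs_continuous_nondecreasing_density _ _ _ _ ab acV ndV.
have [g2 ig2 E2] := abs_continuous_nondecreasing_density _ _ _ _ ab
  (abs_continuousD _ _ _ _ _ acV acN) ndW.
pose g t := g1 t - g2 t.
have ig : lebesgue_measure.-integrable [set: R] (EFin \o g).
  apply: eq_integrable (integrableB measurableT ig1 ig2) => // t _ /=.
have E x : x \in `[a, b] ->
    (\int[lebesgue_measure]_(t in `]a, x]) (g t)%:E = (f x - f a)%:E)%E.
  move=> xab; rewrite /g.
  under eq_integral do rewrite EFinB.
  rewrite integralB_EFin ?E1 ?E2//.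
  - by rewrite -EFinB; congr EFin; lra.
  - exact: integrableS ig1.
  - exact: integrableS ig2.
exists g; split=> //.
have locg : locally_integrable [set: R] g.
  by apply: open_integrable_locally => //; exact: openT.
have igI y : lebesgue_measure.-integrable [set` Interval (BRight a) (BRight y)] (EFin \o g).
  exact: integrableS ig.
(* Lebesgue differentiation: the primitive of g has derivative g almost everywhere. Near an interior
   point, f is this primitive plus the constant f a. *)
have := FTC1 igI locg.
apply: filterS; first exact: (ae_filter_ringOfSetsType lebesgue_measure).
move=> t Ft tab.
pose F y := (\int[lebesgue_measure]_(t in `]a, y]) g t)%R.
have [|dF dFE] := Ft; first by rewrite lte_fin (itvP tab).
have fE y : y \in `[a, b] -> f y = F y + f a.
  by move=> yab; rewrite /F /Rintegral E//= subrK.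
rewrite -dFE !derive1E.
have -> : 'D_1 f t = 'D_1 (fun y => F y + f a) t.
  apply: near_eq_derive; near=> y; apply: fE; apply: subset_itv_oo_cc.
  by near: y; exact: near_in_itvoo.
have dFt : is_derive t 1 F ('D_1 F t) by exact: derivableP.
have dFa : is_derive t 1 (fun y => F y + f a) ('D_1 F t + 0) by exact: is_deriveD.
by rewrite derive_val addr0.
Unshelve. all: by end_near. Qed.

(** Equality of [derive1 f] with the density almost everywhere transfers integrability and
    integrals, but not Borel measurability, which is therefore assumed. *)
Lemma abs_continuous_FTC2 (R : realType) (a b : R) (f : R -> R) :
  a < b -> abs_continuous a b f -> measurable_fun `[a, b] (derive1 f) ->
  lebesgue_measure.-integrable `[a, b] (fun t => (derive1 f t)%:E) /\
  forall x, x \in `[a, b] ->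
    (\int[lebesgue_measure]_(t in `[a, x]) (derive1 f t)%:E = (f x - f a)%:E)%E.
Proof.
move=> ab acf; have [g [ig E]] := abs_continuous_derive1 _ _ _ _ ab acf.
set f' : R -> R := derive1 f => aeE mf'.
have mg := measurable_int _ ig.
have mf : measurable_fun `[a, b] (EFin \o f') by exact/measurable_EFinP.
have oo_ae x : x \in `[a, b] -> ae_eq lebesgue_measure `]a, x[%classic
    (EFin \o f') (EFin \o g).
  move=> xab; move: aeE.
  apply: filterS; first exact: (ae_filter_ringOfSetsType lebesgue_measure).
  move=> t tE; rewrite /= in_itv/= => /andP[at_ tx]; rewrite tE// in_itv/= at_.
  by rewrite (lt_le_trans tx)// (itvP xab).
have sub x : x \in `[a, b] -> `]a, x[%classic `<=` `[a, b]%classic.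
  move=> xab t; rewrite /= !in_itv/= => /andP[/ltW -> /ltW /le_trans]; apply.
  by rewrite (itvP xab).
(* Endpoints have measure zero, so integrals may be taken over the open interval, where the a.e.
   equality is available. *)
have intE (h : R -> \bar R) x : a <= x -> measurable_fun `[a, x] h ->
    (\int[lebesgue_measure]_(t in `]a, x[) h t =
     \int[lebesgue_measure]_(t in `[a, x]) h t)%E.
  move=> ax mh; rewrite integral_itv_obnd_cbnd.
    rewrite integral_itv_bndo_bndc//.
    by apply: measurable_funS mh => // t; rewrite /= !in_itv/= => /andP[-> /ltW].
  by apply: measurable_funS mh => // t; rewrite /= !in_itv/= => /andP[/ltW -> /ltW].
have bab : b \in `[a, b] by rewrite in_itv/= lexx ltW.
split.
  apply/integrableP; split=> //.
  rewrite -intE ?(ltW ab)//; last exact: measurableT_comp.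
  have -> : (\int[lebesgue_measure]_(t in `]a, b[) `|(f' t)%:E| =
      \int[lebesgue_measure]_(t in `]a, b[) `|(g t)%:E|)%E.
    apply: ge0_ae_eq_integral => //.
    - apply: measurableT_comp => //; exact: measurable_funS (sub _ bab) mf.
    - by apply: measurableT_comp => //; exact: measurable_funTS.
    - exact: (ae_eq_abse (oo_ae _ bab)).
  have /integrableP[_] := ig; apply: le_lt_trans.
  by apply: ge0_subset_integral => //; exact: measurableT_comp.
move=> x xab.
have ax : a <= x by rewrite (itvP xab).
have mfx : measurable_fun `[a, x] (EFin \o f').
  apply: measurable_funS mf => // t; rewrite /= !in_itv/= => /andP[-> /le_trans].
  by apply; rewrite (itvP xab).
rewrite -intE//.
transitivity (\int[lebesgue_measure]_(t in `]a, x[) (g t)%:E)%E.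
  apply: ae_eq_integral => //; last exact: oo_ae.
    exact: measurable_funS (sub _ xab) mf.
  exact: measurable_funTS.
by rewrite -E// integral_itv_bndo_bndc//; exact: measurable_funTS.
Qed.

(** * Hyperbolic functions and the cosh divergence *)

Lemma is_derive_expRN (R : realType) (x : R) :
  is_derive x 1 (fun v : R => expR (- v)) (- expR (- x)).
Proof. by apply: is_derive_eq; rewrite mulrN1. Qed.

Lemma is_derive_sinh (R : realType) (x : R) : is_derive x 1 sinh (cosh x).
Proof.
have dN := is_derive_expRN _ x.
have -> : sinh = (fun v : R => 2^-1 *: (expR v - expR (- v))).
  by apply/funext => v; rewrite /sinh mulrC.
rewrite (_ : cosh x = 2^-1 *: (expR x - - expR (- x))).
  by apply: is_deriveZ; apply: is_deriveB.
by rewrite opprK /cosh mulrC.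
Qed.

Lemma is_derive_cosh (R : realType) (x : R) : is_derive x 1 cosh (sinh x).
Proof.
have dN := is_derive_expRN _ x.
have -> : cosh = (fun v : R => 2^-1 *: (expR v + expR (- v))).
  by apply/funext => v; rewrite /cosh mulrC.
rewrite (_ : sinh x = 2^-1 *: (expR x + - expR (- x))).
  by apply: is_deriveZ; apply: is_deriveD.
by rewrite /sinh mulrC.
Qed.

Lemma cosh_gt1 (R : realType) (x : R) : x != 0 -> 1 < cosh x.
Proof.
move=> x0; have := expR_gt1Dx x0.
have := @expR_gt1Dx _ (- x); rewrite oppr_eq0 => /(_ x0).
by rewrite /cosh; lra.
Qed.

Lemma cosh_ge1 (R : realType) (x : R) : 1 <= cosh x.
Proof.
have [->|/cosh_gt1/ltW//] := eqVneq x 0.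
by rewrite /cosh oppr0 expR0; lra.
Qed.

Lemma sinh_gt_id (R : realType) (x : R) : 0 < x -> x < sinh x.
Proof.
move=> x0.
have dS (y : R) : is_derive y 1 (fun v => sinh v - v) (cosh y - 1).
  by have dy := is_derive_sinh _ y; apply: is_deriveB.
have [|c + E] := MVT x0 (fun y _ => dS y).
  by apply: derivable_within_continuous => y _; have [] := dS y.
rewrite in_itv/= => /andP[c0 _].
have s0 : sinh (0 : R) = 0 by rewrite /sinh oppr0 subrr mul0r.
have c1 : 1 < cosh c by apply: cosh_gt1; rewrite gt_eqF.
by rewrite -subr_gt0; move: E; rewrite s0 !subr0 => ->; rewrite mulr_gt0// subr_gt0.
Qed.

Lemma sinhB (R : realType) (x y : R) :
  sinh x - sinh y = 2 * cosh ((x + y) / 2) * sinh ((x - y) / 2).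
Proof.
set u := (x + y) / 2; set v := (x - y) / 2.
have -> : x = u + v by rewrite /u /v; lra.
have -> : y = u - v by rewrite /u /v; lra.
rewrite /sinh /cosh !opprD !opprK !expRD.
lra.
Qed.

(** With h = (y - x) / 2 > 0, the product formula and cosh >= 1 give sinh y - sinh x >= 2 sinh h > 2
    h. The mean value theorem applied directly on [x, y] might pick the point 0, where cosh - 1
    vanishes. *)
Lemma sinh_sub_id_lt (R : realType) (x y : R) : x < y -> sinh x - x < sinh y - y.
Proof.
move=> xy; have h0 : 0 < (y - x) / 2 by lra.
have s1 := sinh_gt_id _ _ h0; have c1 := cosh_ge1 _ ((y + x) / 2).
have := sinhB _ y x; nra.
Qed.

(** For the auxiliary [g], the difference [g v - g w] is the gap between the two sides; g' is
    negative left of w and positive right of it because sinh - id increases strictly. *)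
Lemma cosh_bregman_gt (R : realType) (v w : R) : v != w ->
  2^-1 * (v - w) ^+ 2 < cosh_bregman v w.
Proof.
move=> vw; rewrite cosh_bregmanE.
pose g (u : R) := cosh u - (sinh w * u + 2^-1 * (u - w) ^+ 2).
have dg (u : R) : is_derive u 1 g (sinh u - u - (sinh w - w)).
  have d1 := is_derive_cosh _ u.
  apply: is_derive_eq.
  by rewrite /GRing.scale/=; lra.
have cg p q : {within `[p, q], continuous g}.
  by apply: derivable_within_continuous => y _; have [] := dg y.
suff : 0 < g v - g w by rewrite /g; lra.
have [lt_vw|lt_wv|/eqP] := ltgtP v w; last by rewrite (negPf vw).
- have [c] := MVT lt_vw (fun y _ => dg y) (cg _ _).
  rewrite in_itv/= => /andP[vc cw] E.
  by have := sinh_sub_id_lt _ _ _ cw; nra.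
- have [c] := MVT lt_wv (fun y _ => dg y) (cg _ _).
  rewrite in_itv/= => /andP[wc cv] ->.
  by have := sinh_sub_id_lt _ _ _ wc; nra.
Qed.

Lemma cosh_bregman_ge (R : realType) (v w : R) :
  2^-1 * (v - w) ^+ 2 <= cosh_bregman v w.
Proof.
have [->|/cosh_bregman_gt/ltW//] := eqVneq v w.
by rewrite cosh_bregmanE !subrr expr0n !mulr0 subrr.
Qed.

(** * Log-coordinates *)

(** By compactness gamma has a positive minimum on [a, b], and ln is Lipschitz above it. *)
Lemma abs_continuous_log_coord (R : realType) (a b : R) (gamma : R -> R) :
  a <= b -> (forall t, t \in `[a, b] -> 0 < gamma t) ->
  abs_continuous a b gamma -> abs_continuous a b (log_coord gamma).
Proof.
move=> ab g0 acg.
have cg := abs_continuous_within_continuous _ _ _ _ acg.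
have [c cab cmin] := EVT_min ab cg.
have gc0 := g0 _ cab.
(* This comes from ln (s / t) <= s / t - 1; the one-sided bound is used for (s, t) and for (t,
   s). *)
have lnD (s t : R) : gamma c <= t -> 0 < s -> ln s - ln t <= (gamma c)^-1 * `|s - t|.
  move=> ct s0; have t0 : 0 < t by exact: lt_le_trans ct.
  rewrite -ln_div ?posrE//.
  have -> : s / t = 1 + (s - t) / t by field; rewrite gt_eqF.
  apply: (le_trans (le_ln1Dx _)).
    by rewrite mulrBl divff ?gt_eqF// ltrBrDl subrr divr_gt0.
  apply: (le_trans (ler_norm _)); rewrite normrM mulrC ler_wpM2r//.
  by rewrite gtr0_norm ?invr_gt0// lef_pV2.
apply: (abs_continuous_lipschitz_comp _ _ _ (gamma c)^-1 (@ln R) _ _ _ acg).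
  by rewrite invr_gt0.
move=> s t sab tab; rewrite ler_norml lnD ?cmin ?g0// andbT.
by rewrite lerNl opprB distrC lnD ?cmin ?g0.
Qed.

(* No differentiability is assumed: [gamma] and its logarithm are differentiable
   at the same points, and [derive1] is 0 at all the others. *)
Lemma derive1_log_coord (R : realType) (gamma : R -> R) (t : R) :
  (\forall s \near t, 0 < gamma s) ->
  derive1 (log_coord gamma) t = derive1 gamma t / gamma t.
Proof.
move=> g0; have gt0 : 0 < gamma t := nbhs_singleton g0.
rewrite !derive1E.
have dln : is_derive (gamma t) 1 (@ln R) (gamma t)^-1 by exact: is_derive1_ln.
have [dg|ndg] := pselect (derivable gamma t 1).
  have dgt : is_derive t 1 gamma ('D_1 gamma t) by exact: derivableP.
  have dc := is_derive1_comp dln dgt.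
  by rewrite -[log_coord gamma]/(@ln R \o gamma) derive_val mulrC.
have ndl : ~ derivable (log_coord gamma) t 1.
  move=> dl; apply: ndg.
  have dlt : is_derive t 1 (log_coord gamma) ('D_1 (log_coord gamma) t).
    exact: derivableP.
  have [dc _] := is_derive1_comp (is_derive_expR (log_coord gamma t)) dlt.
  apply: near_eq_derivable dc; near=> s.
  by rewrite /= /log_coord lnK// posrE; near: s.
have -> : 'D_1 gamma t = 0 by exact: dvgP.
have -> : 'D_1 (log_coord gamma) t = 0 by exact: dvgP.
by rewrite mul0r.
Unshelve. all: by end_near. Qed.

Lemma cosh_bregman_K (R : realType) (v w : R) :
  cosh_bregman v w = K v - K w - sinh w * (v - w).
Proof. by rewrite /cosh_bregman K_derive1. Qed.

Lemma measurable_cosh (R : realType) : measurable_fun [set: R] (@cosh R).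
Proof.
apply: continuous_measurable_fun => x.
by have [/derivable1_diffP/differentiable_continuous] := is_derive_cosh _ x.
Qed.

(* Measurability is with respect to the Borel sets, so it would not follow from
   a.e. equality with a measurable function. *)
Lemma measurable_derive1_log_coord (R : realType) (a b : R) (gamma : R -> R) :
  a < b -> admissible a b gamma ->
  measurable_fun `[a, b] (derive1 (log_coord gamma)).
Proof.
move=> ab [g0 acg L2].
have mg' : measurable_fun `[a, b] (derive1 gamma).
  apply/measurable_restrictT => //.
  exact: (set_mem (sub_Lfun_mfun L2)).
have mg : measurable_fun `[a, b] gamma.
  apply: subspace_continuous_measurable_fun => //.
  exact: abs_continuous_within_continuous.
(* The quotient formula needs positivity near t, hence the open interval; adding the endpoints
   preserves measurability. The reciprocal of gamma is then written as exp (- ln gamma), a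
   composition of measurable functions. *)
apply: (@measurable_fun_itv_cc _ _ _ false true).
apply: (eq_measurable_fun (fun t => derive1 gamma t * expR (- ln (gamma t)))).
  move=> t /set_mem/= tab.
  have tcc := subset_itv_oo_cc tab.
  rewrite derive1_log_coord ?expRN ?lnK ?posrE ?g0//.
  have := near_in_itvoo tab; apply: filterS => s sab.
  exact/g0/subset_itv_oo_cc.
apply: (@measurable_funS _ _ _ _ `[a, b]) => //; first exact: subset_itv_oo_cc.
apply: measurable_funM => //.
apply: measurableT_comp => //; apply: measurableT_comp => //.
exact: measurableT_comp (@measurable_ln R) mg.
Qed.

(** * The log-linear path and the action identity *)

Lemma derive1_log_linear_path (R : realType) (a b xa xb t : R) :
  derive1 (log_coord (log_linear_path a b xa xb)) t = log_slope a b xa xb.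
Proof.
have -> : log_coord (log_linear_path a b xa xb) =
    (fun t => log_slope a b xa xb * t + (ln xa - log_slope a b xa xb * a)).
  apply/funext => s; rewrite /log_coord /log_linear_path expRK /log_slope.
  by ring.
rewrite derive1E.
have H : is_derive t 1 (fun t => log_slope a b xa xb * t +
    (ln xa - log_slope a b xa xb * a)) (log_slope a b xa xb).
  by apply: is_derive_eq; rewrite /GRing.scale/= mulr1 addr0.
by rewrite derive_val.
Qed.

(** An identity of extended reals, where both sides may be +oo; the extension by 0 outside [a, b]
    turns into the domain of integration. *)
Lemma L2_norm_sqr (R : realType) (a b : R) (f : R -> R) :
  (L2_norm a b f ^+ 2 = \int[lebesgue_measure]_(t in `[a, b]) ((f t) ^+ 2)%:E)%E.
Proof.
rewrite /L2_norm unlock /= poweR12_sqrt; last first.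
  by apply: integral_ge0 => x _; rewrite lee_fin powR_ge0.
rewrite -expe2 sqr_sqrte; last by apply: integral_ge0 => x _; rewrite lee_fin powR_ge0.
rewrite [RHS]integral_mkcond; apply: eq_integral => x _.
rewrite /patch; case: ifPn => _ /=.
  by rewrite powR_mulrn// real_normK// num_real.
by rewrite normr0 powR0.
Qed.

Theorem theorem4p13 (R : realType) (a b xa xb : R) (gamma : R -> R) :
  a < b -> 0 < xa -> 0 < xb ->
  kinetically_admissible a b gamma ->
  gamma a = xa -> gamma b = xb ->
  let gamma_s := log_linear_path a b xa xb in
  let dxi_s := log_slope a b xa xb in
  let dxi := derive1 (log_coord gamma) in
  [/\ (kinetic_action a b gamma = kinetic_action a b gamma_s +
        \int[lebesgue_measure]_(t in `[a, b]) (cosh_bregman (dxi t) dxi_s)%:E)%E,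
      (kinetic_action a b gamma - kinetic_action a b gamma_s >=
        (2^-1)%:E *
          \int[lebesgue_measure]_(t in `[a, b]) ((dxi t - dxi_s) ^+ 2)%:E)%E,
      ((2^-1)%:E *
          \int[lebesgue_measure]_(t in `[a, b]) ((dxi t - dxi_s) ^+ 2)%:E =
        (2^-1)%:E * L2_norm a b (fun t => dxi t - dxi_s)%R ^+ 2)%E
    & (kinetic_action a b gamma - kinetic_action a b gamma_s =
        (2^-1)%:E *
          \int[lebesgue_measure]_(t in `[a, b]) ((dxi t - dxi_s) ^+ 2)%:E)%E
      <-> (forall t, t \in `[a, b] -> gamma t = gamma_s t)].
Proof.
move=> ab xa0 xb0 [adm finK] ga gb gamma_s w dxi.
have [g0 acg _] := adm.
have acl := abs_continuous_log_coord _ _ _ _ (ltW ab) g0 acg.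
have mdxi : measurable_fun `[a, b] dxi := measurable_derive1_log_coord _ _ _ _ ab adm.
have [idxi FTC] := abs_continuous_FTC2 _ _ _ _ ab acl mdxi.
have bab : b \in `[a, b] by rewrite in_itv/= lexx ltW.
have ba0 : b - a != 0 by rewrite subr_eq0 gt_eqF.
have muI : lebesgue_measure (`[a, b]%classic : set R) = (b - a)%:E.
  by rewrite lebesgue_measure_itv/= lte_fin ab -EFinB.
have icst (c : R) : lebesgue_measure.-integrable `[a, b] (fun=> c%:E).
  apply/integrableP; split; first exact: measurable_cst.
  by rewrite integral_cst//= muI -EFinM ltry.
have K0 (v : R) : 0 <= K v by rewrite /K subr_ge0 cosh_ge1.
have mK : measurable_fun `[a, b] (fun t => K (dxi t)).
  apply: measurable_funB => //.
  exact: measurableT_comp (measurable_cosh _) mdxi.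
(* Finite action makes [K (dxi t)] integrable, so the integrals below are real numbers that can be
   subtracted. *)
have iK : lebesgue_measure.-integrable `[a, b] (fun t => (K (dxi t))%:E).
  apply/integrableP; split; first exact/measurable_EFinP.
  by under eq_integral do rewrite gee0_abs ?lee_fin//.
have kinE : kinetic_action a b gamma =
    (\int[lebesgue_measure]_(t in `[a, b]) K (dxi t))%:E.
  by rewrite /kinetic_action /Rintegral fineK//; exact: integrable_fin_num iK.
have kin_sE : kinetic_action a b gamma_s = (K w * (b - a))%:E.
  rewrite /kinetic_action; under eq_integral do rewrite derive1_log_linear_path.
  by rewrite integral_cst//= muI.
(* The end values enter here: the mean of [dxi] is [w]. *)
have intdxi : \int[lebesgue_measure]_(t in `[a, b]) dxi t = w * (b - a).
  by rewrite /Rintegral FTC//= /log_coord ga gb /w /log_slope divfK.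
pose D t := cosh_bregman (dxi t) w.
have DE t : D t = K (dxi t) - K w - sinh w * (dxi t - w) by exact: cosh_bregman_K.
have i1 : lebesgue_measure.-integrable `[a, b] (EFin \o (fun t => K (dxi t) - K w)).
  exact: (integrableB _ iK (icst (K w))).
have i2 : lebesgue_measure.-integrable `[a, b] (EFin \o (fun t => dxi t - w)).
  exact: (integrableB _ idxi (icst w)).
have i3 : lebesgue_measure.-integrable `[a, b] (EFin \o (fun t => sinh w * (dxi t - w))).
  exact: (integrableZl _ (sinh w) i2).
have iD : lebesgue_measure.-integrable `[a, b] (fun t => (D t)%:E).
  have i13 : lebesgue_measure.-integrable `[a, b]
      (fun t => (K (dxi t) - K w - sinh w * (dxi t - w))%:E).
    exact: (integrableB _ i1 i3).
  by apply: eq_integrable i13 => // t _; rewrite DE.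
have intD : \int[lebesgue_measure]_(t in `[a, b]) D t =
    \int[lebesgue_measure]_(t in `[a, b]) K (dxi t) - K w * (b - a).
  under eq_Rintegral do rewrite DE.
  have cstE (c : R) : \int[lebesgue_measure]_(t in `[a, b]) c = c * (b - a).
    by rewrite Rintegral_cst//= muI.
  have dxi0 : \int[lebesgue_measure]_(t in `[a, b]) (sinh w * (dxi t - w)) = 0.
    transitivity (sinh w * \int[lebesgue_measure]_(t in `[a, b]) (dxi t - w)).
      exact: RintegralZl.
    have -> : \int[lebesgue_measure]_(t in `[a, b]) (dxi t - w) =
        \int[lebesgue_measure]_(t in `[a, b]) dxi t -
        \int[lebesgue_measure]_(t in `[a, b]) w.
      by apply: RintegralB; [|exact: idxi|exact: icst].
    by rewrite intdxi cstE subrr mulr0.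
  transitivity (\int[lebesgue_measure]_(t in `[a, b]) (K (dxi t) - K w) -
      \int[lebesgue_measure]_(t in `[a, b]) (sinh w * (dxi t - w))).
    exact: RintegralB.
  rewrite dxi0 subr0 -cstE.
  by apply: RintegralB; [|exact: iK|exact: icst].
have intDE : (\int[lebesgue_measure]_(t in `[a, b]) (D t)%:E =
    kinetic_action a b gamma - kinetic_action a b gamma_s)%E.
  rewrite kinE kin_sE -EFinB -intD /Rintegral fineK//.
  exact: integrable_fin_num iD.
pose q t := (dxi t - w) ^+ 2.
have mq : measurable_fun `[a, b] q.
  by apply: measurable_funX; exact: measurable_funB.
have qD t : 2^-1 * q t <= D t by exact: cosh_bregman_ge.
have q0 t : 0 <= 2^-1 * q t by rewrite mulr_ge0// sqr_ge0.
(* Square integrability of [dxi - w] follows from the finite action, through domination by [D]. *)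
have iq : lebesgue_measure.-integrable `[a, b] (fun t => (2^-1 * q t)%:E).
  apply: le_integrable iD => //.
    by apply/measurable_EFinP; exact: measurable_funM.
  by move=> t _ /=; rewrite lee_fin !ger0_norm// (le_trans (q0 t)).
have intq : ((2^-1)%:E * \int[lebesgue_measure]_(t in `[a, b]) (q t)%:E =
    \int[lebesgue_measure]_(t in `[a, b]) (2^-1 * q t)%:E)%E.
  under [RHS]eq_integral do rewrite EFinM.
  rewrite ge0_integralZl_EFin//; first by move=> t _; rewrite lee_fin sqr_ge0.
  exact/measurable_EFinP.
split.
- by rewrite -/D intDE kinE kin_sE -!EFinB -EFinD addrC subrK.
- rewrite -intDE -/q intq; apply: le_integral => // t _.
  by rewrite lee_fin.
- by rewrite L2_norm_sqr.
rewrite -intDE -/q intq; split=> [E t tab|E].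
(* A nonnegative integrand with integral 0 vanishes almost everywhere. *)
- have h0 : (\int[lebesgue_measure]_(t in `[a, b]) `|(D t - 2^-1 * q t)%:E| = 0)%E.
    under eq_integral do rewrite gee0_abs ?lee_fin ?subr_ge0// EFinB.
    rewrite integralB_EFin// E subee//.
    exact: integrable_fin_num iq.
  have mh : measurable_fun `[a, b] (fun t => (D t - 2^-1 * q t)%:E).
    have ih : lebesgue_measure.-integrable `[a, b] (fun t => (D t - 2^-1 * q t)%:E).
      exact: (integrableB _ iD iq).
    exact: measurable_int ih.
  have aeh : ae_eq lebesgue_measure `[a, b]%classic
      (fun t => (D t - 2^-1 * q t)%:E) (cst 0%E).
    by apply/ae_eq_integral_abs.
  (* The strict divergence bound excludes [dxi s != w] wherever D and q / 2 agree. *)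
  have aew : ae_eq lebesgue_measure `[a, b]%classic (fun t => (dxi t)%:E) (fun=> w%:E).
    apply: (@filterS _ _ (ae_filter_ringOfSetsType lebesgue_measure) _ _ _ aeh).
    move=> s hs sab; have [->//|dw] := eqVneq (dxi s : R) w.
    have := cosh_bregman_gt _ _ _ dw; rewrite -/(D s) -/(q s).
    by have [/subr0_eq ->] := hs sab; rewrite ltxx.
  have at_ : a <= t by rewrite (itvP tab).
  have tb : t <= b by rewrite (itvP tab).
  have sub : `[a, t]%classic `<=` `[a, b]%classic.
    by apply: subset_itvl; rewrite bnd_simp.
  have lnE : ln (gamma t) - ln (gamma a) = w * (t - a).
    apply: EFin_inj; rewrite -[LHS](FTC _ tab).
    transitivity (\int[lebesgue_measure]_(s in `[a, t]) w%:E)%E.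
      apply: ae_eq_integral => //.
        by apply/measurable_EFinP; apply: measurable_funS mdxi.
      apply: (@filterS _ _ (ae_filter_ringOfSetsType lebesgue_measure) _ _ _ aew).
      by move=> s hs sat; exact: hs (sub _ sat).
    rewrite integral_cst//= lebesgue_measure_itv/= lte_fin.
    (* The length of [a, t] is given by a test on a < t, so t = a is a separate case. *)
    move: at_; rewrite le_eqVlt => /predU1P[->|->].
      by rewrite ltxx mule0 subrr mulr0.
    by rewrite -EFinB.
  rewrite -(@lnK _ (gamma t)) ?posrE ?g0// /gamma_s /log_linear_path; congr expR.
  by move: lnE; rewrite ga /w /log_slope => /eqP; rewrite subr_eq => /eqP ->; ring.
(* Equality on [a, b] gives equality in a neighbourhood only at interior points, so the derivatives
   are compared there. *)
- have dxiE t : t \in `]a, b[ -> dxi t = w.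
    move=> tab; have -> : w = derive1 (log_coord gamma_s) t.
      by rewrite derive1_log_linear_path.
    rewrite /dxi !derive1E.
    apply: near_eq_derive; have := near_in_itvoo tab; apply: filterS => s sab.
    by rewrite /log_coord E//; exact: subset_itv_oo_cc.
  (* At the endpoints [dxi] may differ from [w]; removing these two null points shows that both
     integrals are 0. *)
  have zero (h : R -> R) : measurable_fun `[a, b] (EFin \o h) ->
      (forall t, dxi t = w -> h t = 0) ->
      (\int[lebesgue_measure]_(t in `[a, b]) (h t)%:E = 0)%E.
    move=> mh h0.
    have moo : measurable_fun `]a, b] (EFin \o h).
      by apply: measurable_funS mh => //; exact: subset_itv_oc_cc.
    rewrite -integral_itv_obnd_cbnd// -integral_itv_bndo_bndc; last first.
      by apply: measurable_funS moo => //; exact: subset_itv_oo_oc.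
    apply: integral0_eq => t tab; rewrite h0//; exact: dxiE.
  rewrite !zero//.
  + exact: measurable_int iq.
  + by move=> t tw; rewrite /q tw subrr expr0n mulr0.
  + exact: measurable_int iD.
  + by move=> t tw; rewrite DE tw !subrr mulr0 subr0.
Qed.
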